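(* Let $X$ be a real inner-product space with induced norm $\|\cdot\|$, let $L>0$, and let $f:X\to\mathbb{R}$ be convex and $L$-Lipschitz continuously differentiable, with nonempty solution set $\Omega=\arg\min_{x\in X} f(x)$ and optimal value $f^*=\min_{x\in X} f(x)$. Let $\bar\alpha\in(0,1/L]$, let $x_0\in X$ be arbitrary, and let the sequence $(x_k)_{k\ge 0}$ be generated by gradient descent with constant step size, $$x_{k+1}=x_k-\bar\alpha\nabla f(x_k),\qquad k=0,1,2,\dots.$$ Then $f(x_k)$ converges to $f^*$ at rate $o(1/k)$, that is, $\lim_{k\to\infty} k\,(f(x_k)-f^* )=0$.
   Context: A function $f:X\to\mathbb{R}$ is $L$-Lipschitz continuously differentiable if it is differentiable with gradient $\nabla f(x)\in X$ at every $x\in X$ (the vector representing the derivative through the inner product) and $\|\nabla f(x)-\nabla f(y)\|\le L\|x-y\|$ for all $x,y\in X$. *)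

(* Defs.v *)
From mathcomp Require Import all_boot all_order all_algebra.
From mathcomp Require Import all_classical all_reals all_analysis.
Set Implicit Arguments.
Unset Strict Implicit.
Unset Printing Implicit Defensive.
Import Order.TTheory GRing.Theory Num.Theory.
Import numFieldNormedType.Exports.
Local Open Scope classical_set_scope.
Local Open Scope ring_scope.

(* The real inner-product space is a [normedModType] (not assumed complete)
   together with a symmetric positive definite bilinear form; the two
   structures are tied by this predicate. *)
Definition induces_norm (R : realType) (X : normedModType R)
    (dot : {dot X for idfun}) : Prop :=
  forall x : X, `|x| = Num.sqrt (dot x x).

(* [differentiable] is Frechet differentiability. Since [dot] is positive
   definite, there is at most one such [g]. *)
Definition is_gradient (R : realType) (X : normedModType R)
    (dot : {dot X for idfun}) (f : X -> R^o) (x g : X) : Prop :=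
  differentiable f x /\ forall h : X, 'd f x h = dot g h.

Definition lipschitz_differentiable (R : realType) (X : normedModType R)
    (dot : {dot X for idfun}) (L : R) (f : X -> R^o) (gradf : X -> X) : Prop :=
  (forall x : X, is_gradient dot f x (gradf x)) /\
  (forall x y : X, `|gradf x - gradf y| <= L * `|x - y|).

Definition argmin (R : realType) (T : Type) (f : T -> R) : set T :=
  [set x | forall y : T, f x <= f y].

Definition is_minimum (R : realType) (A : set R) (m : R) : Prop :=
  A m /\ lbound A m.

(* Main.v *)
Require Import Defs.
From mathcomp Require Import all_boot all_order all_algebra.
From mathcomp Require Import all_classical all_reals all_analysis.
From mathcomp Require Import zify lra.
Set Implicit Arguments.
Unset Strict Implicit.
Unset Printing Implicit Defensive.
Import Order.TTheory GRing.Theory Num.Theory.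
Import numFieldNormedType.Exports.
Local Open Scope classical_set_scope.
Local Open Scope ring_scope.

(** With [d_k = f (x_k) - f^*], the first-order convexity inequality at
    [x_(k+1)] and [|g_(k+1) - g_k| <= |g_k|] (where [g_k] is the gradient at
    [x_k]; this uses [alpha L <= 1]) give
    [d_(k+1) <= d_k - alpha/2 |g_(k+1)|^2].
    Expanding [|x_(k+1) - xs|^2] for a minimizer [xs] then shows that
    [|x_(k+1) - xs|^2 + 2 alpha d_k] drops by at least [2 alpha d_(k+1)] at each
    step. So [d] is nonincreasing and summable, hence [k d_k] tends to [0]. *)

Section RealDot.
Context (R : realType) (X : normedModType R) (dot : {dot X for idfun}).
Implicit Types u v : X.

Lemma dotC u v : dot u v = dot v u.
Proof. by rewrite hermC expr0 mul1r. Qed.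

Lemma dotNl u v : dot (- u) v = - dot u v.
Proof. exact: linearNl. Qed.

Lemma dotNr u v : dot u (- v) = - dot u v.
Proof. by rewrite dotC dotNl dotC. Qed.

Lemma dotZl (a : R) u v : dot (a *: u) v = a * dot u v.
Proof. exact: linearZl_LR. Qed.

Lemma dotZr (a : R) u v : dot u (a *: v) = a * dot u v.
Proof. by rewrite dotC dotZl dotC. Qed.

Lemma dotBB u v : dot (u - v) (u - v) = dot u u - 2 * dot u v + dot v v.
Proof. by rewrite hnormB expr0 /=; lra. Qed.

Lemma dot_ge0 u : 0 <= dot u u.
Proof.
have [->|u0] := eqVneq u 0; last by rewrite ltW// neq0_dnorm_gt0.
by rewrite -[X in dot X _](scale0r (0 : X)) dotZl mul0r.
Qed.

Hypothesis dotX : induces_norm dot.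

Lemma sqr_norm_dot u : `|u| ^+ 2 = dot u u.
Proof. by rewrite dotX sqr_sqrtr// dot_ge0. Qed.

(** The derivative along [y - x] is the limit from the right of difference quotients, and convexity
    bounds each quotient with step [t] in (0, 1] by [f y - f x]. *)
Lemma convex_gradient_le (f : X -> R^o) (x g y : X) :
  convex_function setT f -> is_gradient dot f x g ->
  f x + dot g (y - x) <= f y.
Proof.
move=> fcvx [fx gE].
have dq := diff_derivable (v := y - x) fx.
rewrite -lerBrDl -gE -deriveE// /derive cvg_at_rightE//.
apply: limr_le.
  by apply/cvg_ex; exists ('D_(y - x) f x); exact: cvg_dnbhs_at_right.
near=> t.
have t0 : 0 < t by [].
have t1 : t <= 1 by near: t; exact: nbhs_right_le.
have := fcvx (Itv01 (ltW t0) t1) y x.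
rewrite !in_setT => /(_ isT isT).
move=> H.
rewrite /=; have -> : t *: (y - x) + x = t *: y + (1 - t) *: x.
  by rewrite scalerBr scalerBl scale1r addrA addrAC.
rewrite -ler_pdivlMl ?invr_gt0// invrK.
have : t * f y + (1 - t) * f x >= f (t *: y + (1 - t) *: x) by [].
lra.
Unshelve. all: end_near. Qed.
End RealDot.

(** By monotonicity each of the [n - N] terms from [N] to [n - 1] is at least [d n], so
    [(n - N) * d n] is at most a block of a convergent series, small once [N] is large. *)
Lemma nonincreasing_summable_cvg (R : realType) (d : R^nat) (C : R) :
  (forall k, 0 <= d k) -> (forall k, d k.+1 <= d k) ->
  (forall n, series d n <= C) ->
  (fun k => k%:R * d k) @ \oo --> (0 : R).
Proof.
move=> d0 dS dC.
have dD m n : (m <= n)%N -> d n <= d m.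
  by move/nonincreasing_seqP: dS; apply.
have nd : nondecreasing_seq (series d) by apply: nondecreasing_series => ? _ _.
have cd : cvgn (series d).
  by apply: nondecreasing_is_cvgn => //; exists C => _ [n _ <-].
have block N n : (N <= n)%N -> (n - N)%:R * d n <= series d n - series d N.
  move=> Nn; rewrite sub_series_geq// mulr_natl -GRing.sumr_const_nat.
  by apply: ler_sum_nat => i /andP[_ /ltnW]; exact: dD.
apply/cvgrPdist_le => e e0.
have e2 : 0 < e / 2 by rewrite divr_gt0.
have [N _ HN] := (cvgrPdist_le _ _).1 cd _ e2.
(* For [n >= 2N] one has [n <= 2 (n - N)]; this factor 2 is why the tail was taken below [e / 2]. *)
exists N.*2 => // n /= Nn.
have Nn' : (N <= n)%N by rewrite (leq_trans _ Nn)// -addnn leq_addr.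
rewrite sub0r normrN ger0_norm ?mulr_ge0//.
have n2 : n%:R <= 2 * (n - N)%:R :> R.
  by rewrite -natrM ler_nat mulnBr -addnn in Nn *; lia.
have lN : series d n - series d N <= e / 2.
  rewrite (le_trans _ (HN N (leqnn N)))// ger0_norm ?lerB// ?subr_ge0;
  exact: nondecreasing_cvgn_le.
have := block _ _ Nn'; have := ler_wpM2r (d0 n) n2; lra.
Qed.

(** The gradient inequality at the new point, tested against [x], yields a decrease of
    [alpha * dot g' g]; squaring [|g' - g| <= |g|] gives [dot g' g >= dot g' g' / 2]. *)
Lemma gradient_step_decrease (R : realType) (X : normedModType R)
    (dot : {dot X for idfun}) (dotX : induces_norm dot)
    (f : X -> R^o) (x g g' : X) (alpha : R) :
  convex_function setT f -> 0 <= alpha ->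
  is_gradient dot f (x - alpha *: g) g' -> `|g' - g| <= `|g| ->
  f (x - alpha *: g) + alpha / 2 * dot g' g' <= f x.
Proof.
move=> fcvx a0 fg' gg.
have := convex_gradient_le x fcvx fg'.
rewrite subKr dotZr; apply: le_trans; rewrite lerD2l -mulrA ler_wpM2l//.
have : `|g' - g| ^+ 2 <= `|g| ^+ 2 by rewrite lerXn2r ?nnegrE.
by rewrite !(sqr_norm_dot dotX) dotBB; lra.
Qed.

Theorem theorem1 (R : realType) (X : normedModType R)
    (dot : {dot X for idfun}) (dotX : induces_norm dot)
    (L : R) (L_gt0 : 0 < L)
    (f : X -> R^o) (gradf : X -> X)
    (f_convex : convex_function setT f)
    (f_diff : lipschitz_differentiable dot L f gradf)
    (Omega_neq0 : argmin f !=set0)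
    (fstar : R) (fstar_min : is_minimum (range f) fstar)
    (alpha : R) (alpha_gt0 : 0 < alpha) (alpha_le : alpha <= L^-1)
    (x : nat -> X)
    (x_step : forall k : nat, x k.+1 = x k - alpha *: gradf (x k)) :
  (fun k : nat => k%:R * (f (x k) - fstar)) @ \oo --> (0 : R).
Proof.
have [[xs _ fxs] fmin] := fstar_min.
have [fgrad gLip] := f_diff.
pose d k : R := f (x k) - fstar; pose g k := gradf (x k).
have d_ge0 k : 0 <= d k by rewrite subr_ge0; apply: fmin; exists (x k).
have dec k : d k.+1 + alpha / 2 * dot (g k.+1) (g k.+1) <= d k.
  have := @gradient_step_decrease R X dot dotX f (x k) (g k) (g k.+1) alpha f_convex.
  rewrite -x_step /d => /(_ (ltW alpha_gt0) (fgrad _)) H.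
  rewrite addrAC lerD2r; apply: H.
  rewrite (le_trans (gLip _ _))// x_step addrAC subrr add0r normrN normrZ.
  rewrite gtr0_norm// mulrA ler_piMl//.
  by rewrite -(mulfV (lt0r_neq0 L_gt0)) ler_pM2l.
have gg_ge0 k : 0 <= alpha / 2 * dot (g k) (g k).
  by rewrite mulr_ge0 ?dot_ge0 ?divr_ge0 ?ltW.
pose D k := dot (x k - xs) (x k - xs).
(* The cross term of the expanded square is controlled by convexity at [x k]:
   [dot (g k) (x k - xs) >= d k]. *)
have Dstep k : D k.+1 + 2 * alpha * d k <=
    D k + alpha ^+ 2 * dot (g k) (g k).
  have := convex_gradient_le xs f_convex (fgrad (x k)).
  rewrite fxs -(opprB (x k)) dotNr dotC -/(g k) => H.
  rewrite /D x_step addrAC (dotBB dot (x k - xs)) !dotZr dotZl -/(g k) /d.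
  have := ler_wpM2l (ltW alpha_gt0) H.
  by nra.
(* The indices are shifted because [dec k] controls the gradient at [k.+1]: multiplied by
   [2 * alpha], it absorbs the squared gradient term of [Dstep k.+1]. *)
pose V k := D k.+1 + 2 * alpha * d k.
have Vstep k : V k.+1 + 2 * alpha * d k.+1 <= V k.
  have := Dstep k.+1; have := ler_wpM2l (ltW alpha_gt0) (dec k).
  by rewrite /V; nra.
have V_ge0 k : 0 <= V k.
  by rewrite /V addr_ge0 ?dot_ge0// mulr_ge0// mulr_ge0// ltW.
(* Telescoping [Vstep] only reaches the terms from [d 1] on, so [d 0] is added on both sides. *)
have Vseries n : V n + 2 * alpha * series d n.+1 <= V 0%N + 2 * alpha * d 0%N.
  elim: n => [|n IH]; first by rewrite /series/= big_nat1.
  rewrite seriesSr; have := Vstep n; lra.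
apply: (@nonincreasing_summable_cvg _ d
  ((V 0%N + 2 * alpha * d 0%N) / (2 * alpha))) => // [k|n].
  by have := dec k; have := gg_ge0 k.+1; lra.
rewrite ler_pdivlMr ?mulr_gt0// mulrC.
(* [Vseries n] bounds the sum up to and including [d n]; that last term is nonnegative and is
   dropped. *)
have := Vseries n; have := V_ge0 n; have := ler_wpM2l (ltW alpha_gt0) (d_ge0 n).
by rewrite seriesSr mulr0; lra.
Qed.
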